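(* A law-invariant coherent risk measure on $L^1$ is finite (on $L^1$) if and only if it is expectation-dominated.
   Context: Fix an atomless probability space $(\Omega,\mathcal F,\mathbb P)$; random variables are real-valued and almost surely equal ones are identified; $L^1$ is the set of integrable random variables and $L^1_+$ the set of nonnegative ones in $L^1$. A coherent risk measure on $L^1$ is a map $\rho:L^1\to(-\infty,\infty]$, finite on constants, satisfying monotonicity ($\rho(X)\le\rho(Y)$ if $X\le Y$), cash invariance ($\rho(X+c)=\rho(X)+c$ for $c\in\mathbb R$), convexity ($\rho(\lambda X+(1-\lambda)Y)\le\lambda\rho(X)+(1-\lambda)\rho(Y)$ for $\lambda\in(0,1)$) and positive homogeneity ($\rho(\lambda X)=\lambda\rho(X)$ for $\lambda>0$). It is law-invariant if $\rho(X)=\rho(Y)$ whenever $X$ and $Y$ have the same distribution. It is finite if $\rho(X)<\infty$ for all $X\in L^1$. It is expectation-dominated if there exists $c>0$ such that $\rho(X)\le c\,\mathbb E[X]$ for all $X\in L^1_+$. *)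

(* Defs.v *)
From HB Require Import structures.
From mathcomp Require Import all_boot all_order all_algebra.
From mathcomp Require Import all_classical all_reals all_analysis.

Set Implicit Arguments.
Unset Strict Implicit.
Unset Printing Implicit Defensive.

Import Order.TTheory GRing.Theory Num.Theory.
Import numFieldNormedType.Exports.

Local Open Scope classical_set_scope.
Local Open Scope ring_scope.

Definition atomless (d : measure_display) (T : measurableType d)
    (R : realType) (P : probability T R) : Prop :=
  forall A : set T, measurable A -> (0 < P A)%E ->
    exists B : set T,
      [/\ measurable B, B `<=` A, (0 < P B)%E & (P B < P A)%E].

(* Integrable random variables, before identification of almost surely equal
   ones: the quotient [LspaceType1 P] carries no vector space structure in the
   library.  Maps on L^1 are the maps on [L1 P] compatible with almost sure
   equality (field [coherent_ae] below). *)
Definition L1 (d : measure_display) (T : measurableType d) (R : realType)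
    (P : probability T R) : Type :=
  LfunType P (@lexx _ _ (1%E : \bar R)).

Definition L1_cst (d : measure_display) (T : measurableType d) (R : realType)
    (P : probability T R) (c : R) : L1 P :=
  Lfun_Sub (@lexx _ _ (1%E : \bar R)) (Lfun_cst P c 1).

Section RiskMeasures.
Context (d : measure_display) (T : measurableType d) (R : realType)
  (P : probability T R).

(* Values in ]-oo, +oo] are encoded as values in \bar R other than -oo, so the
   sum in [coherent_convex] is never of the form +oo - oo. *)
Record coherent_risk_measure (rho : L1 P -> \bar R) : Prop := {
  coherent_ae : forall X Y : L1 P, {ae P, forall t, X t = Y t} ->
    rho X = rho Y ;
  coherent_gtNy : forall X : L1 P, (-oo < rho X)%E ;
  coherent_cst_fin : forall c : R, rho (L1_cst P c) \is a fin_num ;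
  coherent_monotone : forall X Y : L1 P, {ae P, forall t, X t <= Y t} ->
    (rho X <= rho Y)%E ;
  coherent_cash : forall (X : L1 P) (c : R),
    rho (X + L1_cst P c) = (rho X + c%:E)%E ;
  coherent_convex : forall (X Y : L1 P) (l : R), 0 < l -> l < 1 ->
    (rho (l *: X + (1 - l) *: Y)%R
      <= l%:E * rho X + (1 - l)%R%:E * rho Y)%E ;
  coherent_pos_homogeneous : forall (X : L1 P) (l : R), 0 < l ->
    rho (l *: X) = (l%:E * rho X)%E
}.

(* Distributions are compared on measurable sets only: as functions on [set R]
   their values elsewhere are junk. *)
Definition law_invariant (rho : L1 P -> \bar R) : Prop :=
  forall X Y : L1 P,
    (forall A : set (measurableTypeR R), measurable A ->
       distribution P X A = distribution P Y A) ->
    rho X = rho Y.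

Definition finite_risk_measure (rho : L1 P -> \bar R) : Prop :=
  forall X : L1 P, (rho X < +oo)%E.

Definition expectation_dominated (rho : L1 P -> \bar R) : Prop :=
  exists c : R, 0 < c /\
    forall X : L1 P, {ae P, forall t, 0 <= X t} ->
      (rho X <= c%:E * 'E_P[X])%E.

End RiskMeasures.

(* Main.v *)
(* If [rho] is finite but not expectation-dominated, positive homogeneity gives
   nonnegative [Z_n] with [rho Z_n = n + 1] and summable expectations. Their sum
   [S] is integrable and dominates every [Z_n], so monotonicity forces
   [rho S = +oo]. Conversely [rho X <= rho `|X| <= c * E `|X|]. *)
Require Import Defs.
From HB Require Import structures.
From mathcomp Require Import all_boot all_order all_algebra.
From mathcomp Require Import all_classical all_reals all_analysis.
From mathcomp Require Import measurable_realfun.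

Import Order.TTheory GRing.Theory Num.Theory.
Local Open Scope classical_set_scope.
Local Open Scope ring_scope.

(** By monotone convergence the pointwise series of the [|f n|] has finite integral, so it is finite
    almost everywhere and bounds each of its terms, hence each [f n]. *)
Lemma Lfun1_summable_ub (d : measure_display) (T : measurableType d)
    (R : realType) (mu : {measure set T -> \bar R}) (f : nat -> T -> R) :
  (forall n, f n \in Lfun mu 1) ->
  (\sum_(n <oo) \int[mu]_t `|(f n t)%:E| < +oo)%E ->
  exists2 g : T -> R, g \in Lfun mu 1 & forall n, {ae mu, forall t, f n t <= g t}.
Proof.
move=> Lf sum_lty.
pose h n t : \bar R := `|(f n t)%:E|%E.
have mh n : measurable_fun setT (h n).
  apply: measurableT_comp => //.
  by have /Lfun1_integrable/measurable_int := Lf n.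
pose F t : \bar R := (\sum_(n <oo) h n t)%E.
have F_ge0 t : (0 <= F t)%E by apply: nneseries_ge0 => n _ _; exact: abse_ge0.
have mF : measurable_fun setT F.
  by apply: (@ge0_emeasurable_sum _ _ _ _ h xpredT) => // n t _ _; exact: abse_ge0.
have intF : mu.-integrable setT F.
  apply/integrableP; split=> //.
  under eq_integral do rewrite gee0_abs//.
  by rewrite integral_nneseries// => n t _; exact: abse_ge0.
(* [fine] sends [+oo] to 0, so [fine \o F] may fail to dominate [f n] where the series diverges;
   that set is null, which is why the bound is only almost everywhere. *)
exists (fine \o F) => [|n].
  apply/Lfun1_integrable; apply: le_integrable intF => //.
    by apply/measurable_EFinP; apply: measurableT_comp.
  move=> t _; rewrite (gee0_abs (F_ge0 t)) /= ger0_norm ?fine_ge0//.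
  by have := F_ge0 t; case: (F t) => //= *; exact: leey.
apply: filterS (integrable_ae measurableT intF) => t /(_ I) F_fin.
rewrite -lee_fin /= fineK//; apply: (@le_trans _ _ (h n t)).
  by rewrite lee_fin ler_norm.
rewrite /F (nneseriesD1 (n := n)) => [|k _|]//; last exact: abse_ge0.
by rewrite leeDl// nneseries_ge0// => k _ _; exact: abse_ge0.
Qed.

(** Turns bounds on expectations into the bounds on integrals of absolute values that
    [Lfun1_summable_ub] asks for. *)
Lemma ae_ge0_expectation_abse (d : measure_display) (T : measurableType d)
    (R : realType) (P : probability T R) (X : T -> R) :
  X \in Lfun P 1 -> {ae P, forall t, 0 <= X t} ->
  'E_P[X]%E = (\int[P]_t `|(X t)%:E|)%E.
Proof.
move=> /Lfun1_integrable/measurable_int mX X0; rewrite unlock.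
apply: ae_eq_integral => //; first exact: measurableT_comp.
by apply: filterS X0 => t X0 _; rewrite gee0_abs// lee_fin.
Qed.

Section RiskMeasures.
Context (d : measure_display) (T : measurableType d) (R : realType)
  (P : probability T R) (rho : L1 P -> \bar R)
  (hcoh : coherent_risk_measure rho).

Lemma expectation_dominated_finite :
  expectation_dominated rho -> finite_risk_measure rho.
Proof.
move=> [c [c0 dom]] X.
have LX : (Num.norm \o X : T -> R) \in Lfun P 1 by apply: Lfun_norm; exact: LfunP.
pose Y : L1 P := Lfun_Sub (@lexx _ _ (1%E : \bar R)) LX.
have YE t : Y t = `|X t| by [].
apply: (@le_lt_trans _ _ (rho Y)).
  by apply: (coherent_monotone hcoh); apply: aeW => t; rewrite YE ler_norm.
apply: (le_lt_trans (dom Y _)); first by apply: aeW => t; rewrite YE.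
by rewrite ltey_eq fin_numM// expectation_fin_num.
Qed.

Lemma finite_expectation_dominated :
  finite_risk_measure rho -> expectation_dominated rho.
Proof.
move=> fin; apply: contrapT => ndom.
have scaled n : exists Z : L1 P, [/\ {ae P, forall t, 0 <= Z t},
    ('E_P[Z] <= (1 / (2 ^ n.+1)%:R)%:E)%E & rho Z = n.+1%:R%:E].
  (* If [c * E[X] < rho X], rescaling [X] so that [rho] becomes [n.+1] brings its expectation below
     [n.+1 / c], which is [1 / 2 ^ n.+1]. *)
  pose c : R := n.+1%:R * (2 ^ n.+1)%:R.
  have c0 : 0 < c by rewrite mulr_gt0// ltr0n ?expn_gt0.
  have [X X0 cX] : exists2 X : L1 P, {ae P, forall t, 0 <= X t} &
      (c%:E * 'E_P[X] < rho X)%E.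
    apply: contrapT => noX; apply: ndom; exists c; split=> // X X0.
    by rewrite leNgt; apply/negP => cX; apply: noX; exists X.
  have LX : (X : T -> R) \in Lfun P 1 by exact: LfunP.
  have rX : (fine (rho X))%:E = rho X.
    by rewrite fineK// fin_real// fin (coherent_gtNy hcoh).
  have eX : (fine ('E_P[X]))%:E = ('E_P[X])%E.
    by rewrite fineK// expectation_fin_num.
  have EX0 : 0 <= fine ('E_P[X])%E.
    rewrite fine_ge0// ae_ge0_expectation_abse//.
    by apply: integral_ge0 => t _; exact: abse_ge0.
  move: cX; rewrite -rX -eX -EFinM lte_fin => cX.
  (* The strict failure of domination makes [rho X] positive even when [E[X] = 0]. *)
  have r0 : 0 < fine (rho X).
    by apply: le_lt_trans cX; rewrite mulr_ge0// ltW.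
  (* Normalizing by [rho X] rather than by ['E_P[X]], which may vanish. *)
  pose a : R := n.+1%:R / fine (rho X).
  have a0 : 0 < a by rewrite divr_gt0// ltr0n.
  exists (a *: X); split.
  - by apply: filterS X0 => t X0; rewrite mulr_ge0// ltW.
  - have -> : ('E_P[(a *: X : L1 P)] = a%:E * 'E_P[X])%E.
      rewrite -expectationZl//; congr (expectation P _).
      by apply/funext => t; exact: mulrC.
    rewrite -eX -EFinM lee_fin /a mulrAC ler_pdivrMr// mulrAC mul1r.
    by rewrite ler_pdivlMr ?ltr0n ?expn_gt0// mulrAC ltW.
  - by rewrite (coherent_pos_homogeneous hcoh)// -rX -EFinM /a divfK// gt_eqF.
have [Z HZ] := choice scaled.
have [||g Lg Zg] := @Lfun1_summable_ub _ _ _ P (fun n => Z n : T -> R).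
- by move=> n; exact: LfunP.
- apply: le_lt_trans (ltry 1).
  (* The expectations are compared with the geometric series of terms [1 / 2 ^ n.+1], whose sum is
     at most 1. *)
  apply: le_trans (epsilon_trick0 xpredT (@ler01 R)).
  apply: lee_nneseries => [n _ _|n _]; first exact: integral_ge0.
  have [Z0 EZ _] := HZ n.
  by rewrite -ae_ge0_expectation_abse//; exact: LfunP.
pose S : L1 P := Lfun_Sub (@lexx _ _ (1%E : \bar R)) Lg.
have rS n : (n.+1%:R%:E <= rho S)%E.
  by have [_ _ <-] := HZ n; apply: (coherent_monotone hcoh) => //; exact: Zg.
have rSy : rho S = +oo%E.
  (* At index [Num.trunc r] the lower bound on [rho S] is [(Num.trunc r).+1], which exceeds [r]. *)
  apply: eq_infty => r; apply: le_trans (rS (Num.trunc r)).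
  by rewrite lee_fin ltW// truncnS_gt.
by have := fin S; rewrite rSy ltxx.
Qed.

End RiskMeasures.

Theorem proposition4p9 (d : measure_display) (T : measurableType d)
  (R : realType) (P : probability T R) (hP : atomless P)
  (rho : L1 P -> \bar R)
  (hcoh : coherent_risk_measure rho) (hlaw : law_invariant rho) :
  finite_risk_measure rho <-> expectation_dominated rho.
Proof.
split.
  exact: finite_expectation_dominated.
exact: expectation_dominated_finite.
Qed.
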